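(* There is a polynomial $p$ such that, given an arbitrary connectivity function $\lambda$ on a finite set $E$ with $|E|=n$ (accessible only through an oracle returning $\lambda(X)$ for queried $X\subseteq E$), one can establish whether or not $\lambda$ is the connectivity function $\gamma_G$ of some graph $G$ with edge set $E$ using at most $p(n)$ evaluations of $\lambda$.
   Context: A connectivity function on a finite set $E$ is a function $\lambda:2^E\to\mathbb R$ such that $\lambda(\emptyset)=0$, $\lambda(X)=\lambda(E-X)$ for all $X\subseteq E$, and $\lambda(X\cap Y)+\lambda(X\cup Y)\le\lambda(X)+\lambda(Y)$ for all $X,Y\subseteq E$. For a graph $G$ (loops and parallel edges allowed) with edge set $E$ and no isolated vertices, and $X\subseteq E$, let $V(X)$ denote the set of vertices incident with some edge of $X$. The connectivity function of $G$ is $\gamma_G(X)=|V(X)|+|V(E-X)|-|V(E)|$ for $X\subseteq E$; equivalently $\gamma_G(X)$ is the number of vertices incident both with an edge of $X$ and with an edge of $E-X$. A connectivity function is graphic (comes from a graph with $n$ edges) if it equals $\gamma_G$ for some such graph $G$ whose edge set is its ground set. *)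

(* Defs.v *)
From HB Require Import structures.
From mathcomp Require Import all_boot all_order all_algebra.
From mathcomp Require Import reals.

Set Implicit Arguments.
Unset Strict Implicit.
Unset Printing Implicit Defensive.

Import Order.TTheory GRing.Theory Num.Theory.
Local Open Scope ring_scope.

Definition connectivity_function (R : realType) (E : finType)
    (lambda : {set E} -> R) : Prop :=
  [/\ lambda set0 = 0,
      forall X : {set E}, lambda X = lambda (~: X)
    & forall X Y : {set E},
        lambda (X :&: Y) + lambda (X :|: Y) <= lambda X + lambda Y].

(* An edge is given by its set of ends: one end for a loop, two otherwise.
   Distinct edges may have the same ends, so parallel edges are allowed. *)
Record graph (E : finType) := Graph {
  vertex : finType;
  ends : E -> {set vertex};
  card_ends : forall e : E, (0 < #|ends e| <= 2)%N;
  no_isolated : forall v : vertex, exists e : E, v \in ends e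
}.

Definition vertices_of (E : finType) (G : graph E) (X : {set E}) :
    {set vertex G} :=
  \bigcup_(e in X) ends G e.

Definition gamma (R : realType) (E : finType) (G : graph E) (X : {set E}) : R :=
  #|vertices_of G X|%:R + #|vertices_of G (~: X)|%:R
    - #|vertices_of G [set: E]|%:R.

Definition graphic (R : realType) (E : finType) (lambda : {set E} -> R) : Prop :=
  exists G : graph E, forall X : {set E}, lambda X = gamma R G X.

(* A deterministic adaptive oracle algorithm: the next query, or the final
   answer, depends only on the oracle's previous replies. Computation between
   queries is unrestricted; only evaluations of the oracle are counted. *)
Inductive oracle_algorithm (R : realType) (E : finType) : Type :=
| Answer (b : bool)
| Query (X : {set E}) (next : R -> oracle_algorithm R E).

Arguments Answer {R E} b.
Arguments Query {R E} X next.

Fixpoint output (R : realType) (E : finType) (A : oracle_algorithm R E)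
    (lambda : {set E} -> R) : bool :=
  match A with
  | Answer b => b
  | Query X next => output (next (lambda X)) lambda
  end.

(* Repeated queries of the same set are counted with multiplicity. *)
Fixpoint evaluations (R : realType) (E : finType) (A : oracle_algorithm R E)
    (lambda : {set E} -> R) : nat :=
  match A with
  | Answer _ => 0%N
  | Query X next => (evaluations (next (lambda X)) lambda).+1
  end.

(* Main.v *)
Require Import Defs.
From HB Require Import structures.
From mathcomp Require Import all_boot all_order all_algebra.
From mathcomp Require Import boolp reals.
From mathcomp Require Import ring lra zify.

Set Implicit Arguments.
Unset Strict Implicit.
Unset Printing Implicit Defensive.

Import Order.TTheory GRing.Theory Num.Theory.
Local Open Scope ring_scope.

(* [gamma] counts the vertices whose star [X] splits, and every edge lies in at
   most two stars.

   Identification: a graphic function is determined by its values on sets of at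
   most three edges. Inclusion-exclusion on a triple gives the number of stars
   of size at least 4 containing it. As an edge lies in at most two stars, the
   number of large stars containing a set is attained at a triple inside it, so
   all these numbers, hence the multiplicities of the large stars, are known.
   The stars of size 2 and 3 contribute a weighted graph cut function, because
   splitting a triple is half the sum of splitting its three pairs; such a
   function is determined by pairs.

   Verification: for a given [G], the marginal of an edge [e] in [gamma] at [X]
   depends only on how [X] meets the two stars through [e], and is attained at
   a subset of [X] among quadratically many probes. By submodularity, agreement
   at the probes bounds all marginals of [lambda] by those of [gamma], and as
   both functions vanish at the empty set and at [E], they coincide.

   The algorithm queries the triples, chooses a graph that fits the replies, and
   queries the probes of this graph. *)

(** * How a set of edges splits a single star *)

Section Splitting.
Variables (R : realType) (E : finType).
Implicit Types (S X Y : {set E}) (e f g : E).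

Definition splits S X := (S :&: X != set0) && ~~ (S \subset X).

Lemma meets1 S e : (S :&: [set e] != set0) = (e \in S).
Proof. by rewrite setIC setI_eq0 disjoints1 negbK. Qed.

Lemma meets2 S e f : (S :&: [set e; f] != set0) = (e \in S) || (f \in S).
Proof. by rewrite setIUr setU_eq0 negb_and !meets1. Qed.

(** For nonempty [S], splitting is meeting minus containment. The alternating sum of the meeting
    terms is the indicator that [S] contains the triple, that of the containment terms the indicator
    that [S] equals it. *)
Lemma splits_triple S e f g : e != f -> e != g -> f != g ->
  (splits S [set e; f; g])%:R - (splits S [set e; f])%:R
    - (splits S [set e; g])%:R - (splits S [set f; g])%:R
    + (splits S [set e])%:R + (splits S [set f])%:R + (splits S [set g])%:R
  = (([set e; f; g] \subset S) && (3 < #|S|)%N)%:R :> R.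
Proof.
move=> ef eg fg.
(* Every term is a function of four booleans, membership of [e], [f], [g] in [S] and nonemptiness of
   [rest]; the end is an exhaustive check. *)
pose rest := S :\: [set e; f; g].
have card3 : #|[set e; f; g]| = 3.
  by rewrite -setUA !cardsU1 cards1 !inE negb_or ef eg fg.
have -> : ([set e; f; g] \subset S) && (3 < #|S|)%N
   = [&& e \in S, f \in S, g \in S & rest != set0].
  rewrite !subUset !sub1set -!andbA.
  case: (boolP (e \in S)) => //= eS; case: (boolP (f \in S)) => //= fS.
  case: (boolP (g \in S)) => //= gS.
  rewrite -card_gt0 /rest cardsD.
  have -> : S :&: [set e; f; g] = [set e; f; g].
    by apply/setIidPr; rewrite !subUset !sub1set eS fS gS.
  by rewrite card3 subn_gt0.
have in3 : (S :&: [set e; f; g] != set0) = [|| e \in S, f \in S | g \in S].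
  by rewrite setIUr setU_eq0 negb_and meets2 meets1 orbA.
have sub X : ~~ (S \subset X) = [|| (e \in S) && (e \notin X), (f \in S) && (f \notin X),
    (g \in S) && (g \notin X) | (S :\: [set e; f; g]) :\: X != set0].
  apply/subsetPn/idP => [[x xS xNX]|].
    have [<-|xe] := eqVneq x e; first by rewrite xS xNX.
    have [<-|xf] := eqVneq x f; first by rewrite xS xNX orbT.
    have [<-|xg] := eqVneq x g; first by rewrite xS xNX !orbT.
    apply/orP; right; apply/orP; right; apply/orP; right.
    by apply/set0Pn; exists x; rewrite !inE !negb_or xe xf xg xS xNX.
  case/or4P => [/andP[a b]|/andP[a b]|/andP[a b]|/set0Pn[x]];
    [by exists e|by exists f|by exists g|].
  by rewrite !inE => /and3P[a b c]; exists x.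
have restD X : X \subset [set e; f; g] -> (S :\: [set e; f; g]) :\: X = rest.
  by move=> XT; rewrite setDDl; move/setUidPl: XT => ->.
rewrite /splits !sub in3 !meets2 !meets1.
rewrite !restD ?subUset ?sub1set ?inE ?eqxx ?orbT //.
rewrite !(eq_sym f e, eq_sym g e, eq_sym g f) (negbTE ef) (negbTE eg) (negbTE fg) /=.
by case: (e \in S); case: (f \in S); case: (g \in S); case: (rest != set0) => /=; ring.
Qed.

(** A pair inside [S] contributes 2 if it is all of [S] and 1 if [S] has a third element; the factor
    [4 - #|S|] covers both cases. *)
Lemma splits_pair S e f : (#|S| <= 3)%N -> e != f ->
  (splits S [set e])%:R + (splits S [set f])%:R - (splits S [set e; f])%:R
  = ((e \in S) && (f \in S))%:R * (4 - #|S|%:R) :> R.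
Proof.
move=> S3 ef; rewrite /splits meets2 !meets1.
have sub1 x : x \in S -> (S \subset [set x]) = (#|S| <= 1)%N.
  rewrite -sub1set => xS; have := geq_leqif (subset_leqif_cards xS).
  by rewrite cards1 eqEsubset xS.
have subN x y : x \notin S -> (S \subset [set x; y]) = (S \subset [set y]).
  move=> xS; apply/subsetP/subsetP => H z zS; have := H z zS; rewrite !inE.
    by case/orP => // /eqP zx; rewrite -zx zS in xS.
  by move=> ->; rewrite orbT.
case: (boolP (e \in S)) => eS; last first.
  by rewrite subN //; case: (f \in S) => /=; ring.
case: (boolP (f \in S)) => fS; last first.
  by rewrite setUC subN //=; ring.
have efS : [set e; f] \subset S by rewrite subUset !sub1set eS fS.
have := subset_leq_card efS; rewrite cards2 ef /= => S2.
rewrite !sub1 //.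
have -> : (S \subset [set e; f]) = (#|S| <= 2)%N.
  by have := geq_leqif (subset_leqif_cards efS); rewrite cards2 ef eqEsubset efS.
by move: #|S| S2 S3 => [|[|[|[|n]]]] // _ _ /=; ring.
Qed.

(** With [a] elements of [S] inside [X] and [b] outside, the sum is [a * b * (4 - a - b)], which is
    2 whenever [a] and [b] are positive and [a + b] is at most 3. *)
Lemma splits_small S X : (#|S| <= 3)%N ->
  \sum_(e in X) \sum_(f in ~: X)
     ((splits S [set e])%:R + (splits S [set f])%:R - (splits S [set e; f])%:R)
  = (splits S X)%:R *+ 2 :> R.
Proof.
move=> S3.
transitivity (\sum_(e in X) \sum_(f in ~: X)
     (e \in S)%:R * ((f \in S)%:R * (4 - #|S|%:R)) : R).
  apply: eq_bigr => e eX; apply: eq_bigr => f; rewrite inE => fX.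
  rewrite splits_pair //; last by apply: contraNneq fX => <-.
  by rewrite -mulnb natrM mulrA.
have cnt Y : \sum_(e in Y) (e \in S)%:R = #|S :&: Y|%:R :> R.
  rewrite -sum1_card natr_sum big_mkcond [RHS]big_mkcond /=.
  by apply: eq_bigr => e _; rewrite inE; case: (e \in Y); case: (e \in S).
under eq_bigr => e _ do rewrite -mulr_sumr -mulr_suml cnt.
rewrite -mulr_suml cnt /splits -setD_eq0.
have -> : S :&: ~: X = S :\: X by rewrite setDE.
rewrite -!card_gt0 -(cardsID X S) in S3 *.
move: #|S :&: X| #|S :\: X| S3 => [|[|[|[|a]]]] [|[|[|[|b]]]] //=;
  rewrite ?addnS ?addn0 //= => _; ring.
Qed.

End Splitting.

(** * Subsets of prescribed size in finite sets *)

Lemma subset_of_card (T : finType) (A B : {set T}) k :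
  A \subset B -> (#|A| <= k <= #|B|)%N ->
  exists C : {set T}, [/\ A \subset C, C \subset B & #|C| = k].
Proof.
move=> AB /andP[Ak kB].
have : (k - #|A| <= #|B :\: A|)%N.
  by rewrite cardsD; move/setIidPr: AB => ->; exact: leq_sub2r.
case/card_geqP => s [s_uniq s_size sBA].
exists (A :|: [set x in s]); split; first exact: subsetUl.
  rewrite subUset AB; apply/subsetP => x; rewrite inE => /sBA.
  by rewrite inE => /andP[].
rewrite cardsU; have -> : A :&: [set x in s] = set0.
  apply/setP => x; rewrite !inE; apply/negbTE/negP => /andP[xA /sBA].
  by rewrite inE xA.
by rewrite cards0 subn0 cardsE (card_uniqP s_uniq) s_size subnKC.
Qed.

Lemma card3P (T : finType) (A : {set T}) : #|A| = 3 ->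
  exists x y z, [/\ x != y, x != z, y != z & A = [set x; y; z]].
Proof.
have := enum_uniq A; have := mem_enum A; rewrite cardE.
case: (enum A) => [|x [|y [|z [|? ?]]]] //= memA; rewrite !inE negb_or andbT.
case/andP=> /andP[xy xz] yz _; exists x, y, z; split=> //.
by apply/setP => t; rewrite -memA !inE orbA.
Qed.

(** * Identification of a family of stars from its cut values on triples *)

Section Families.
Variables (R : realType) (E : finType).

(** Models the stars of a graph, whose edges have at most two ends. Families are indexed, so that
    vertices with equal stars count separately. *)
Definition thin (I : finType) (S : I -> {set E}) :=
  forall e, (#|[set i | e \in S i]| <= 2)%N.

Definition cut (I : finType) (S : I -> {set E}) (X : {set E}) : R :=
  \sum_i (splits (S i) X)%:R.

Definition large_degree (I : finType) (S : I -> {set E}) (Y : {set E}) :=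
  #|[set i | (Y \subset S i) && (3 < #|S i|)%N]|.

Definition multiplicity (I : finType) (S : I -> {set E}) (Z : {set E}) :=
  #|[set i | S i == Z]|.

Lemma large_degree_cut (I : finType) (S : I -> {set E}) e f g :
  e != f -> e != g -> f != g ->
  (large_degree S [set e; f; g])%:R =
  cut S [set e; f; g] - cut S [set e; f] - cut S [set e; g] - cut S [set f; g]
  + cut S [set e] + cut S [set f] + cut S [set g].
Proof.
move=> ef eg fg.
rewrite /cut -!sumrB -!big_split /= /large_degree -sum1_card natr_sum big_mkcond /=.
by apply: eq_bigr => i _; rewrite splits_triple // inE; case: ifP.
Qed.

Lemma large_degree_anti (I : finType) (S : I -> {set E}) (Y Z : {set E}) :
  Y \subset Z -> (large_degree S Z <= large_degree S Y)%N.
Proof.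
move=> YZ; apply/subset_leq_card/subsetP => i; rewrite !inE => /andP[Zi ->].
by rewrite (subset_trans YZ Zi).
Qed.

(* At most two members contain a given [e \in Y]; a triple through [e] and,
   for each of these members not containing [Y], a point of [Y] it misses,
   is contained only in members containing [Y]. *)
Lemma large_degree_triple (I : finType) (S : I -> {set E}) (Y : {set E}) :
  thin S -> (2 < #|Y|)%N ->
  exists T : {set E},
    [/\ T \subset Y, #|T| = 3 & large_degree S T = large_degree S Y].
Proof.
move=> thinS Y3.
have /card_gt0P[e eY] : (0 < #|Y|)%N by apply: leq_trans Y3.
(* The default [e] only keeps [missed i] in [Y] when [Y] lies inside [S i]. *)
pose missed i := odflt e [pick y in Y :\: S i].
have missedY i : missed i \in Y.
  by rewrite /missed; case: pickP => //= y; rewrite inE => /andP[].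
have missedP i : ~~ (Y \subset S i) -> missed i \notin S i.
  rewrite /missed; case: pickP => [y|none] /=; first by rewrite inE => /andP[].
  by case/subsetPn => y yY yS; have := none y; rewrite inE yY yS.
pose bad := [set i | (e \in S i) && ~~ (Y \subset S i)].
have [||T [AT TY T3]] := @subset_of_card _ (e |: missed @: bad) Y 3.
- by rewrite subUset sub1set eY; apply/subsetP => _ /imsetP[i _ ->].
- rewrite Y3 andbT cardsU1; apply: (@leq_add _ _ 1 2); first by case: (_ \notin _).
  apply: leq_trans (leq_imset_card _ _) (leq_trans _ (thinS e)).
  by apply/subset_leq_card/subsetP => i; rewrite !inE => /andP[].
exists T; split=> //; apply/eqP; rewrite eqn_leq (large_degree_anti S TY) andbT.
apply/subset_leq_card/subsetP => i; rewrite !inE => /andP[Ti ->]; rewrite andbT.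
apply: contraT => Yi.
have eT : e \in T by rewrite (subsetP AT) ?setU11.
have mT : missed i \in T.
  rewrite (subsetP AT) // inE; apply/orP; right; apply: imset_f.
  by rewrite inE Yi (subsetP Ti).
by have := missedP i Yi; rewrite (subsetP Ti).
Qed.

(** A triple in [Y] attaining the [S]-degree of [Y] has the same [T]-degree, which by monotonicity
    bounds that of [Y]. Exchanging the families gives equality. *)
Lemma large_degree_le (I J : finType) (S : I -> {set E}) (T : J -> {set E}) :
  thin S ->
  (forall Y : {set E}, #|Y| = 3 -> large_degree S Y = large_degree T Y) ->
  forall Y : {set E}, (2 < #|Y|)%N -> (large_degree T Y <= large_degree S Y)%N.
Proof.
move=> thinS eq3 Y Y3; have [Z [ZY Z3 <-]] := large_degree_triple thinS Y3.
by rewrite eq3 // large_degree_anti.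
Qed.

Lemma sum_large (V : nmodType) (I : finType) (S : I -> {set E})
    (F : {set E} -> V) (P : pred {set E}) :
  \sum_(i | P (S i)) F (S i) = \sum_(Z | P Z) F Z *+ multiplicity S Z.
Proof.
rewrite (partition_big S P) //=; apply: eq_bigr => Z PZ.
rewrite -sumr_const; apply: eq_big => [i|i /andP[_ /eqP->]] //.
by rewrite inE andbC; case: eqP => // ->; rewrite PZ.
Qed.

Lemma large_degreeE (I : finType) (S : I -> {set E}) (Y : {set E}) :
  large_degree S Y =
  (\sum_(Z : {set E} | (Y \subset Z) && (3 < #|Z|)) multiplicity S Z)%N.
Proof.
rewrite /large_degree -sum1_card.
under eq_bigl => i do rewrite inE.
rewrite (sum_large S (fun _ => 1%N) (fun Z => (Y \subset Z) && (3 < #|Z|)%N)).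
by apply: eq_bigr => Z _; exact: natn.
Qed.

(** Möbius inversion from the top: the degree of [Z] sums the multiplicities of its supersets, and
    those of the proper ones agree by induction on [#|E| - #|Z|]. *)
Lemma multiplicity_large (I J : finType) (S : I -> {set E}) (T : J -> {set E}) :
  (forall Y : {set E}, (3 < #|Y|)%N -> large_degree S Y = large_degree T Y) ->
  forall Z : {set E}, (3 < #|Z|)%N -> multiplicity S Z = multiplicity T Z.
Proof.
move=> eqD Z; have [n] := ubnP (#|E| - #|Z|); elim: n Z => // n IH Z Zn Z3.
have := eqD Z Z3; rewrite !large_degreeE.
rewrite (bigD1 Z) ?subxx //= [in RHS](bigD1 Z) ?subxx //=.
rewrite (eq_bigr (multiplicity T)); first by move/addIn.
move=> Y /andP[/andP[ZY Y3] YZ]; apply: IH => //.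
have : Z \proper Y by rewrite properEneq eq_sym YZ.
by move/proper_card => ZYn; have := max_card Y; move: Zn ZYn; lia.
Qed.

(* [splits_small] makes the contribution of the members of size at most 3
   twice a sum over pairs. *)
Lemma cut_eq (I J : finType) (S : I -> {set E}) (T : J -> {set E}) :
  thin S -> thin T ->
  (forall e f g, cut S [set e; f; g] = cut T [set e; f; g]) ->
  forall X, cut S X = cut T X.
Proof.
move=> thinS thinT eq3.
(* The entries of a triple may coincide, so pairs and singletons are covered too. *)
have eq2 e f : cut S [set e; f] = cut T [set e; f].
  by rewrite -[[set e]]setUid eq3.
have eq1 e : cut S [set e] = cut T [set e] by rewrite -[[set e]]setUid eq2.
have eqD3 (Y : {set E}) : #|Y| = 3 -> large_degree S Y = large_degree T Y.
  move=> Y3.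
  have [e [f [g [ef eg fg ->]]]] := card3P Y3.
  apply/eqP; rewrite -(eqr_nat R) !large_degree_cut //.
  by rewrite !eq3 !eq2 !eq1.
have eqD (Y : {set E}) : (3 < #|Y|)%N -> large_degree S Y = large_degree T Y.
  move/ltnW => Y3; apply/eqP; rewrite eqn_leq.
  by rewrite (large_degree_le thinS eqD3) ?(large_degree_le thinT) // => Z /eqD3.
have eq_large X : \sum_(i | (3 < #|S i|)%N) (splits (S i) X)%:R =
                  \sum_(j | (3 < #|T j|)%N) (splits (T j) X)%:R :> R.
  pose F Z : R := (splits Z X)%:R; pose P (Z : {set E}) := (3 < #|Z|)%N.
  rewrite (sum_large S F P) (sum_large T F P).
  by apply: eq_bigr => Z Z3; rewrite (multiplicity_large eqD Z3).
pose small (K : finType) (U : K -> {set E}) X : R :=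
  \sum_(i | ~~ (3 < #|U i|)%N) (splits (U i) X)%:R.
have cutD (K : finType) (U : K -> {set E}) X :
    cut U X = \sum_(i | (3 < #|U i|)%N) (splits (U i) X)%:R + small K U X.
  by rewrite /cut (bigID (fun i => (3 < #|U i|)%N)).
have eq_small X : cut S X = cut T X -> small I S X = small J T X.
  by rewrite !cutD eq_large => /addrI.
have small2 (K : finType) (U : K -> {set E}) X : small K U X *+ 2 =
    \sum_(e in X) \sum_(f in ~: X)
      (small K U [set e] + small K U [set f] - small K U [set e; f]).
  rewrite /small -sumrMnl.
  under eq_bigr => i Ui do rewrite -splits_small 1?leqNgt //.
  rewrite exchange_big /=; apply: eq_bigr => e _.
  rewrite exchange_big /=; apply: eq_bigr => f _.
  by rewrite -big_split -sumrB.
move=> X; rewrite !cutD eq_large; congr (_ + _).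
apply: (pmulrnI (isT : (0 < 2)%N)); rewrite /= !small2.
by apply: eq_bigr => e _; apply: eq_bigr => f _; rewrite !eq_small.
Qed.

End Families.

(** * Stars of a graph and verification by probes *)

Section Certificates.
Variables (R : realType) (E : finType).

Definition star (G : graph E) (v : vertex G) : {set E} := [set e | v \in ends G e].

Lemma thin_star (G : graph E) : thin (star (G := G)).
Proof.
move=> e; have /andP[_] := card_ends G e.
by apply: leq_trans; apply/subset_leq_card/subsetP => v; rewrite !inE.
Qed.

Lemma mem_vertices_of (G : graph E) (X : {set E}) v :
  (v \in vertices_of G X) = (star v :&: X != set0).
Proof.
apply/bigcupP/set0Pn => [[e eX ve]|[e]]; first by exists e; rewrite !inE ve.
by rewrite !inE => /andP[ve eX]; exists e.
Qed.

(** Each vertex contributes its meeting with [X] plus its meeting with the complement minus 1. As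
    its star is nonempty, this is 1 if the star is split and 0 otherwise. *)
Lemma gamma_cut (G : graph E) (X : {set E}) :
  gamma R G X = cut R (star (G := G)) X.
Proof.
have card_sum (A : {set vertex G}) : #|A|%:R = \sum_v (v \in A)%:R :> R.
  rewrite -sum1_card natr_sum big_mkcond /=.
  by apply: eq_bigr => v _; case: ifP.
rewrite /gamma !card_sum -big_split -sumrB; apply: eq_bigr => v _ /=.
rewrite !mem_vertices_of setIT -setDE setD_eq0 /splits.
have -> : star v != set0.
  by have [e ve] := no_isolated v; apply/set0Pn; exists e; rewrite inE.
case: (eqVneq (star v :&: X) set0) => [SX|_] /=.
  case: (boolP (star v \subset X)) => [sub|_] /=; last by ring.
  have [e ve] := no_isolated v.
  have : e \in star v :&: X by rewrite (setIidPl sub) inE.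
  by rewrite SX inE.
by case: (star v \subset X) => /=; ring.
Qed.

Lemma gamma_eq (G H : graph E) :
  (forall e f g, gamma R G [set e; f; g] = gamma R H [set e; f; g]) ->
  forall X, gamma R G X = gamma R H X.
Proof.
move=> eq3 X; rewrite !gamma_cut.
apply: cut_eq; [exact: thin_star|exact: thin_star|move=> e f g].
by rewrite -!gamma_cut.
Qed.

(** At an end of [e], a set without [e] may miss the star, meet it without containing the rest of
    it, or contain that rest; the empty set, a singleton and a star without [e] represent these
    cases. *)
Definition probes (G : graph E) (e : E) : seq {set E} :=
  set0 :: [seq [set f] | f <- enum E] ++ [seq star v :\ e | v <- enum (ends G e)].

(** One probe serves each end of [e]; their union is taken without and with [e] to read off a
    marginal. *)
Definition certificate (G : graph E) : seq {set E} :=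
  flatten [seq flatten [seq [:: A :|: B; e |: (A :|: B)]
                       | A <- probes G e, B <- probes G e] | e <- enum E].

Lemma mem_certificate (G : graph E) (e : E) (A B : {set E}) :
  A \in probes G e -> B \in probes G e ->
  (A :|: B \in certificate G) && (e |: (A :|: B) \in certificate G).
Proof.
move=> Ae Be.
have mem_cert X : X \in [:: A :|: B; e |: (A :|: B)] -> X \in certificate G.
  move=> XAB; apply/flatten_mapP; exists e; first exact: mem_enum.
  apply/flattenP; exists [:: A :|: B; e |: (A :|: B)] => //.
  exact: (allpairs_f (fun A B => [:: A :|: B; e |: (A :|: B)])).
by rewrite !mem_cert // !inE eqxx ?orbT.
Qed.

Lemma probe_subset (G : graph E) (e : E) v (X : {set E}) :
  v \in ends G e -> e \notin X ->
  exists A, [/\ A \in probes G e, A \subset X,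
    star v :&: X != set0 -> star v :&: A != set0
    & star v :\ e \subset X -> star v :\ e \subset A].
Proof.
move=> ve eX; case: (boolP (star v :\ e \subset X)) => [sub|nsub].
  exists (star v :\ e); split=> //.
    rewrite !inE mem_cat; apply/orP; right; apply/orP; right.
    by apply: map_f; rewrite mem_enum.
  case/set0Pn => f /setIP[fv fX]; apply/set0Pn; exists f.
  by rewrite !inE in fv *; rewrite fv andbT; apply: contraNneq eX => <-.
have [none|/set0Pn[f /setIP[fv fX]]] := eqVneq (star v :&: X) set0.
  by exists set0; rewrite sub0set inE eqxx.
exists [set f]; rewrite sub1set fX meets1 fv; split=> //.
by rewrite inE mem_cat map_f ?mem_enum ?orbT.
Qed.

Lemma splits_outside (S X : {set E}) e :
  e \notin S -> splits S (e |: X) = splits S X.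
Proof.
move=> eS; rewrite /splits -subDset.
have -> : S :\ e = S by apply/setDidPl; rewrite disjoint_sym disjoints1.
have -> // : S :&: (e |: X) = S :&: X.
by apply/setP => x; rewrite !inE; case: eqP => // ->; rewrite (negbTE eS).
Qed.

Lemma splits_inside (S X : {set E}) e : e \in S -> e \notin X ->
  splits S X = (S :&: X != set0) /\
  splits S (e |: X) = ~~ (S :\ e \subset X).
Proof.
move=> eS eX; rewrite /splits -subDset; split.
  have -> : (S \subset X) = false by apply: contraNF eX => /subsetP->.
  by rewrite andbT.
suff -> : S :&: (e |: X) != set0 by [].
by apply/set0Pn; exists e; rewrite !inE eS eqxx.
Qed.

(** Adding [e] affects only the stars at its ends, according to whether [X] meets the star and
    contains the rest of it. The union of a probe for each end preserves these facts, the converses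
    holding because it lies in [X]. *)
Lemma marginal_probe (G : graph E) (e : E) (X : {set E}) : e \notin X ->
  exists A B, [/\ A \in probes G e, B \in probes G e, A :|: B \subset X
    & gamma R G (e |: (A :|: B)) - gamma R G (A :|: B)
      = gamma R G (e |: X) - gamma R G X].
Proof.
move=> eX.
have [u [v uv]] : exists u v, ends G e = [set u; v].
  have := card_ends G e; case c: #|ends G e| => [|[|[|//]]] // _.
    (* A loop is treated as an edge with two equal ends. *)
    by have /eqP/cards1P[u ->] := c; exists u, u; rewrite setUid.
  by have /eqP/cards2P[u [v [_ ->]]] := c; exists u, v.
have ue : u \in ends G e by rewrite uv !inE eqxx.
have ve : v \in ends G e by rewrite uv !inE eqxx orbT.
have [A [Ae AX Au Au']] := probe_subset ue eX.
have [B [Be BX Bv Bv']] := probe_subset ve eX.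
have ABX : A :|: B \subset X by rewrite subUset AX.
exists A, B; split=> //.
rewrite !gamma_cut /cut -!sumrB; apply: eq_bigr => w _.
case: (boolP (w \in ends G e)) => we; last first.
  by rewrite !splits_outside ?inE // !subrr.
have ew : e \in star w by rewrite inE.
have eAB : e \notin A :|: B by apply: contra eX => /(subsetP ABX).
have [-> ->] := splits_inside ew eX; have [-> ->] := splits_inside ew eAB.
have -> : (star w :&: (A :|: B) != set0) = (star w :&: X != set0).
  apply/idP/idP.
    by apply: contraNneq => wX; rewrite -subset0 -wX setIS.
  move: we; rewrite uv !inE => /orP[/eqP-> /Au|/eqP-> /Bv];
    by rewrite setIUr setU_eq0 negb_and => ->; rewrite ?orbT.
have -> // : (star w :\ e \subset A :|: B) = (star w :\ e \subset X).
apply/idP/idP => [/subset_trans-> //|].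
move: we; rewrite uv !inE => /orP[/eqP-> /Au'|/eqP-> /Bv'] sub.
  exact: subset_trans (subsetUl _ _).
exact: subset_trans (subsetUr _ _).
Qed.

Lemma antitone_of_marginals (g : {set E} -> R) :
  (forall (X : {set E}) e, e \notin X -> g (e |: X) <= g X) ->
  forall X Y : {set E}, X \subset Y -> g Y <= g X.
Proof.
move=> g_step X Y; have [n] := ubnP #|Y :\: X|; elim: n Y => // n IH Y Yn XY.
have [YX|/set0Pn[e]] := eqVneq (Y :\: X) set0.
  by rewrite (_ : Y = X) //; apply/eqP; rewrite eqEsubset XY andbT -setD_eq0 YX.
rewrite inE => /andP[eX eY]; rewrite -(setD1K eY).
apply: le_trans (g_step _ _ _) (IH _ _ _); first by rewrite !inE eqxx.
  rewrite -ltnS; apply: leq_trans Yn; rewrite ltnS; apply: proper_card.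
  rewrite properE setSD ?subsetDl //=; apply/subsetPn; exists e.
    by rewrite inE eX.
  by rewrite !inE eqxx andbF.
by rewrite subsetD1 XY.
Qed.

(* By submodularity each marginal of [lambda] is at most the marginal at the
   probe, so [lambda - gamma] is antitone; it vanishes at both extremes. *)
Lemma certificate_sound (G : graph E) (lambda : {set E} -> R) :
  connectivity_function lambda ->
  (forall X, X \in certificate G -> lambda X = gamma R G X) ->
  forall X, lambda X = gamma R G X.
Proof.
move=> [lambda0 lambdaC submod] agree X.
pose g X := lambda X - gamma R G X.
have anti : forall X Y : {set E}, X \subset Y -> g Y <= g X.
  apply: antitone_of_marginals => Y e eY; rewrite /g.
  have [A [B [Ae Be ABY eqm]]] := marginal_probe G eY.
  have /andP[/agree eqAB /agree eqeAB] := mem_certificate Ae Be.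
  have := submod (e |: (A :|: B)) Y.
  have -> : (e |: (A :|: B)) :&: Y = A :|: B.
    rewrite setIUl (setIidPl ABY).
    have -> : [set e] :&: Y = set0 by apply/eqP; rewrite setI_eq0 disjoints1.
    by rewrite set0U.
  have -> : e |: (A :|: B) :|: Y = e |: Y by rewrite -setUA (setUidPr ABY).
  by rewrite eqAB eqeAB; move: eqm; lra.
have gamma0 : gamma R G set0 = 0.
  by rewrite gamma_cut /cut big1 // => v _; rewrite /splits setI0 eqxx.
have gammaT : gamma R G setT = 0.
  by rewrite gamma_cut /cut big1 // => v _; rewrite /splits subsetT andbF.
have lambdaT : lambda setT = 0 by rewrite lambdaC setCT.
have := anti _ _ (sub0set X); have := anti _ _ (subsetT X).
rewrite /g lambda0 lambdaT gamma0 gammaT; lra.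
Qed.

End Certificates.

(** * The oracle algorithm and its number of evaluations *)

Lemma size_flatten_le T (ss : seq (seq T)) k :
  all (fun s => size s <= k)%N ss -> (size (flatten ss) <= size ss * k)%N.
Proof.
by elim: ss => //= s ss IH /andP[sk /IH]; rewrite size_cat mulSn; exact: leq_add.
Qed.

Section Algorithm.
Variables (R : realType) (E : finType).

Fixpoint query_all (s : seq {set E}) (next : seq R -> oracle_algorithm R E) :
    oracle_algorithm R E :=
  if s is X :: s' then Query X (fun r => query_all s' (fun rs => next (r :: rs)))
  else next [::].

Lemma output_query_all s next lambda :
  output (query_all s next) lambda = output (next (map lambda s)) lambda.
Proof. by elim: s next => //= X s IH next; rewrite IH. Qed.

Lemma evaluations_query_all s next lambda :
  evaluations (query_all s next) lambda =
  (size s + evaluations (next (map lambda s)) lambda)%N.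
Proof. by elim: s next => //= X s IH next; rewrite IH addSn. Qed.

Definition triples : seq {set E} :=
  [seq [set p.1; p.2.1; p.2.2] | p <- enum {: E * (E * E)}].

Definition answer_of (G : graph E) : oracle_algorithm R E :=
  query_all (certificate G)
    (fun rs => Answer (rs == map (gamma R G) (certificate G))).

(** The fitting graph is picked by classical choice, since only oracle calls are counted. *)
Definition recognize : oracle_algorithm R E :=
  query_all triples (fun rs =>
    match pselect (exists G : graph E, rs = map (gamma R G) triples) with
    | left exG => answer_of (projT1 (cid exG))
    | right _ => Answer false
    end).

(** If some graph realizes [lambda], the chosen one agrees with it on triples, hence everywhere by
    [gamma_eq], and passes its certificate. Conversely, a passed certificate is sound. *)
Lemma recognizeP (lambda : {set E} -> R) :
  connectivity_function lambda -> output recognize lambda <-> graphic lambda.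
Proof.
move=> conn; rewrite /recognize output_query_all.
case: pselect => [exG|noG] /=; last first.
  by split=> // -[G lamG]; case: noG; exists G; apply: eq_map.
case: cid => G /= lam3; rewrite /answer_of output_query_all /=; split.
  move/eqP/eq_in_map => agree; exists G; exact: certificate_sound.
case=> H lamH; apply/eqP/eq_map => X; rewrite lamH; apply: gamma_eq => e f g.
rewrite -lamH; move/eq_in_map: lam3 => -> //.
by apply/mapP; exists (e, (f, g)); rewrite ?mem_enum.
Qed.

(** The empty set, [#|E|] singletons and at most two stars without [e]. *)
Lemma size_probes (G : graph E) e : (size (probes G e) <= #|E| + 3)%N.
Proof.
rewrite /= size_cat !size_map -enumT -!cardE -addnS leq_add2l ltnS.
by have /andP[] := card_ends G e.
Qed.

Lemma size_certificate (G : graph E) :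
  (size (certificate G) <= #|E| * ((#|E| + 3) * (#|E| + 3) * 2))%N.
Proof.
rewrite {1}cardE -(size_map (fun e => flatten [seq [:: A :|: B; e |: (A :|: B)]
  | A <- probes G e, B <- probes G e])).
apply: size_flatten_le; apply/allP => _ /mapP[e _ ->].
apply: (@leq_trans (size (probes G e) * size (probes G e) * 2)); last first.
  by rewrite leq_mul2r /= leq_mul ?size_probes.
rewrite -(size_allpairs (fun A B => [:: A :|: B; e |: (A :|: B)])).
by apply: size_flatten_le; apply/allP => _ /allpairsP[AB [_ _ ->]].
Qed.

Lemma evaluations_recognize lambda :
  (evaluations recognize lambda <=
   #|E| ^ 3 + #|E| * ((#|E| + 3) * (#|E| + 3) * 2))%N.
Proof.
rewrite /recognize evaluations_query_all size_map -cardE !card_prod.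
apply: leq_add; first by rewrite !expnS expn0 muln1.
case: pselect => [exG|noG] //=.
by rewrite /answer_of evaluations_query_all addn0 size_certificate.
Qed.

End Algorithm.

Theorem theorem1 (R : realType) :
  exists (p : {poly int}) (A : forall E : finType, oracle_algorithm R E),
    forall (E : finType) (lambda : {set E} -> R),
      connectivity_function lambda ->
      (output (A E) lambda <-> graphic lambda)
      /\ (evaluations (A E) lambda)%:Z <= p.[#|E|%:Z].
Proof.
(* The cubic term pays for the triples, the other for the certificate: [#|E|] edges, a pair of
   probes for each, and two sets for each pair. *)
exists ('X ^+ 3 + 'X * (('X + 3%:P) * ('X + 3%:P) * 2%:P)), (@recognize R).
move=> E lambda conn; split; first exact: recognizeP.
rewrite !(hornerD, hornerM, hornerXn, hornerX, hornerC).
have := evaluations_recognize lambda; rewrite -lez_nat => /le_trans; apply.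
by rewrite !(PoszD, PoszM, expnS, expn0, exprS, expr0).
Qed.
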